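(* Let $D_1=(V_1,\vec{E}_1)$ and $D_2=(V_2,\vec{E}_2)$ be two directed acyclic graphs with finite node sets, and let $D^*=(V_1\cup V_2,\vec{E^*})$ and $D_2'=(V_2,\vec{E}_2')$ be the output of the algorithm FUSE_DAGS on input $(D_1,D_2)$. Then $D^*$ and $D_2'$ are directed acyclic graphs and: 1. $D_1$ and $D_2'$ are embedded in $D^*$: one has $\vec{E^*}=\vec{E}_1\cup\vec{E}_2'$, and, with $S_1=\vec{E}_1\setminus\vec{E}_2'$, $S_2=\vec{E}_2'\setminus\vec{E}_1$ and $S_3=\vec{E}_1\cap\vec{E}_2'$, the projections of $D^*$ satisfy $D^*|_{V_1,\,S_1\cup S_3}=D_1$ and $D^*|_{V_2,\,S_2\cup S_3}=D_2'$. 2. $D_2'$ is obtained from $D_2$ by applying a valid sequence of arc reversals.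
   Context: All graphs are directed, on finite node sets. An arc $(x,y)$ points from $x$ to $y$. For a directed graph $D=(V,\vec{E})$ and $x\in V$, put $P_D(x)=\{y\in V : (y,x)\in\vec{E}\}$ (direct predecessors). A DAG is a directed acyclic graph. For $W\subseteq V$ and $S\subseteq\vec{E}$ a set of arcs between nodes of $W$, the projection $D|_{W,S}$ is the subgraph of $D$ with node set $W$ and arc set $S$. Topological value: for a DAG $D=(V,\vec{E})$, $\tau_D:V\to\mathbb{N}$ is defined recursively by $\tau_D(x)=0$ if $P_D(x)=\emptyset$, and $\tau_D(x)=1+\max\{\tau_D(y): y\in P_D(x)\}$ otherwise (the length of the longest directed path ending at $x$). Arc reversal: reversing an arc $(x,y)$ of a directed graph $D$ replaces $(x,y)$ by $(y,x)$ and adds the arcs of $C_x=\{(z,x): z\in P_D(y)\setminus P_D(x),\ z\neq x\}$ and $C_y=\{(z,y): z\in P_D(x)\setminus P_D(y)\}$, where $P_D$ is taken before the reversal. A sequence of arc reversals is valid if the graph is acyclic after each reversal. The algorithm FUSE_DAGS, on input DAGs $D_1=(V_1,\vec{E}_1)$, $D_2=(V_2,\vec{E}_2)$, maintains graphs $D^*=(V_1\cup V_2,\vec{E^*})$ and $D_2=(V_2,\vec{E}_2)$ (both changing over time) and sets of arcs $DIR$, $REV$, $EQ$. The values $\tau_{D^*}$ and $\tau_{D_2}$ always refer to the current graphs. Initialization: $\vec{E^*}=\vec{E}_1$; $DIR=\{(x,y)\in\vec{E}_2:(x,y)\notin\vec{E^*},\ \tau_{D^*}(x)<\tau_{D^*}(y)\}$;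 $REV=\{(x,y)\in\vec{E}_2:\tau_{D^*}(x)>\tau_{D^*}(y)\}$; $EQ=\{(x,y)\in\vec{E}_2:\tau_{D^*}(x)=\tau_{D^*}(y)\}$. Priority orders (minimal elements are selected first, remaining ties broken arbitrarily): $(x_1,y_1)<_{REV}(x_2,y_2)$ if $\tau_{D_2}(y_1)<\tau_{D_2}(y_2)$, or $\tau_{D_2}(y_1)=\tau_{D_2}(y_2)$ and $\tau_{D_2}(x_1)\ge\tau_{D_2}(x_2)$. $(x_1,y_1)<_{EQ}(x_2,y_2)$ if $\tau_{D^*}(x_1)>\tau_{D^*}(x_2)$, or $\tau_{D^*}(x_1)=\tau_{D^*}(x_2)$ and $\tau_{D_2}(y_1)\ge\tau_{D_2}(y_2)$. First loop. Until $REV=\emptyset$: select a minimal $(x,y)\in REV$ with respect to $<_{REV}$; delete it from $REV$; add $(y,x)$ to $\vec{E^*}$; let $C_x=\{(z,x): z\in P_{D_2}(y)\setminus P_{D_2}(x),\ z\neq x\}$ and $C_y=\{(z,y): z\in P_{D_2}(x)\setminus P_{D_2}(y)\}$ for the current $D_2$; put each arc $(z,w)\in C_x\cup C_y$ into $DIR$ if $\tau_{D^*}(z)<\tau_{D^*}(w)$, into $REV$ if $\tau_{D^*}(z)>\tau_{D^*}(w)$, and into $EQ$ if $\tau_{D^*}(z)=\tau_{D^*}(w)$; then reverse $(x,y)$ in $D_2$, i.e. $\vec{E}_2\leftarrow(\vec{E}_2\cup C_x\cup C_y\cup\{(y,x)\})\setminus\{(x,y)\}$. Second loop. Until $EQ=DIR=\emptyset$: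 $\vec{E^*}\leftarrow\vec{E^*}\cup DIR$; $DIR\leftarrow\emptyset$; then, if $EQ\ne\emptyset$, select a minimal $(x,y)\in EQ$ with respect to $<_{EQ}$; delete it from $EQ$; add $(x,y)$ to $\vec{E^*}$; set $DIR\leftarrow\{(z,y):(z,y)\in EQ\}$ and $EQ\leftarrow EQ\setminus DIR$. Output: the final $D^*$, and the final $D_2$, denoted $D_2'=(V_2,\vec{E}_2')$. *)

(* Defs.v *)
From mathcomp Require Import all_boot.
From Stdlib Require Relation_Operators.

Set Implicit Arguments.
Unset Strict Implicit.
Unset Printing Implicit Defensive.

(* Node sets are subsets of an arbitrary finite type T, so that two graphs may *)
(* share some of their nodes. That arcs join nodes of the graph is part of     *)
(* [is_digraph], not of the record.                                            *)
Record digraph (T : finType) := Digraph {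
  nodes : {set T};
  arcs : {set T * T}
}.

Section Digraphs.
Variable T : finType.
Implicit Types (D G : digraph T) (W : {set T}) (S A : {set T * T}) (x y : T).

Definition is_digraph D : Prop := arcs D \subset setX (nodes D) (nodes D).

(* [cycle] accepts loops (singletons) and closed walks. *)
Definition acyclic D : Prop :=
  forall (x : T) (p : seq T), ~~ cycle [rel u v | (u, v) \in arcs D] (x :: p).

Definition is_dag D : Prop := is_digraph D /\ acyclic D.

Definition preds D x : {set T} := [set y in nodes D | (y, x) \in arcs D].

(* D|_{W,S} is well defined and equal to G. *)
Definition is_projection D W S G : Prop :=
  [/\ W \subset nodes D, S \subset arcs D, S \subset setX W W
    & G = Digraph W S].

(* The recursive definition of the topological value is made structural by a  *)
(* recursion depth; #|T| is enough on acyclic graphs, see [tauE].              *)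
Fixpoint tau_rec D (n : nat) x : nat :=
  if n is n'.+1 then
    if preds D x == set0 then 0
    else (\max_(y in preds D x) tau_rec D n' y).+1
  else 0.

Definition tau D x : nat := tau_rec D #|T| x.

Definition add_arcs D A : digraph T := Digraph (nodes D) (arcs D :|: A).

Definition reversal_Cx D x y : {set T * T} :=
  [set (z, x) | z in (preds D y :\: preds D x) :\ x].

Definition reversal_Cy D x y : {set T * T} :=
  [set (z, y) | z in preds D x :\: preds D y].

Definition reverse_arc D x y : digraph T :=
  Digraph (nodes D)
    ((arcs D :|: reversal_Cx D x y :|: reversal_Cy D x y :|: [set (y, x)])
       :\ (x, y)).

Fixpoint valid_reversals D (s : seq (T * T)) D' : Prop :=
  if s is (x, y) :: s' then
    [/\ (x, y) \in arcs D, acyclic (reverse_arc D x y)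
      & valid_reversals (reverse_arc D x y) s' D']
  else D' = D.

Lemma tauE D x : acyclic D ->
  tau D x = if preds D x == set0 then 0
            else (\max_(y in preds D x) tau D y).+1.
Proof.
move=> acD; pose e := [rel u v | (v, u) \in arcs D].
have ac u p : ~~ cycle e (u :: p).
  apply/negP=> cp; have: cycle [rel u v | (u, v) \in arcs D] (rev (u :: p)).
    by rewrite rev_cycle.
  case def_r: (rev (u :: p)) => [|v r]; last exact/negP/acD.
  by move/(congr1 size): def_r; rewrite size_rev.
have path_uniq p u : path e u p -> uniq (u :: p).
  elim: p u => [|v p IHp] u // up; rewrite cons_uniq.
  have /andP[_ /IHp ->] := up; rewrite andbT; apply/negP=> u_vp.
  case/splitPr: u_vp up => p1 p2; rewrite -cat_rcons cat_path => /andP[cu _].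
  by have /negP := ac u p1; apply.
have stable n u : (forall p, path e u p -> size p != n) ->
    tau_rec D n.+1 u = tau_rec D n u.
  elim: n u => [|n IHn] u no_path; first by have := no_path [::] isT.
  rewrite [LHS]/= [RHS]/=; case: ifP => // _; congr (_.+1).
  apply: eq_bigr => y; rewrite inE => /andP[_ yu]; apply: IHn => p yp.
  by have := no_path (y :: p); rewrite /= yu yp eqSS; apply.
rewrite /tau -stable // => p /path_uniq up.
by have := max_card (mem (x :: p)); rewrite (card_uniqP up) /=; case: ltngtP.
Qed.

End Digraphs.

Definition is_minimal (A : finType) (r : rel A) (X : {set A}) (m : A) : Prop :=
  m \in X /\ forall a, a \in X -> r a m -> r m a.

Record fuse_state (T : finType) := FuseState {
  st_Dstar : digraph T;
  st_D2 : digraph T;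
  st_DIR : {set T * T};
  st_REV : {set T * T};
  st_EQ : {set T * T}
}.

Section Fuse.
Variable T : finType.
Implicit Types (D Dstar : digraph T) (s t : fuse_state T) (a b : T * T).

Definition fuse_init D1 D2 : fuse_state T :=
  let Dstar := Digraph (nodes D1 :|: nodes D2) (arcs D1) in
  {| st_Dstar := Dstar;
     st_D2 := D2;
     st_DIR := [set a in arcs D2 | (a \notin arcs Dstar)
                                   && (tau Dstar a.1 < tau Dstar a.2)];
     st_REV := [set a in arcs D2 | tau Dstar a.1 > tau Dstar a.2];
     st_EQ := [set a in arcs D2 | tau Dstar a.1 == tau Dstar a.2] |}.

Definition prec_REV D2 : rel (T * T) := fun a b =>
  (tau D2 a.2 < tau D2 b.2)
  || ((tau D2 a.2 == tau D2 b.2) && (tau D2 a.1 >= tau D2 b.1)).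

Definition prec_EQ Dstar D2 : rel (T * T) := fun a b =>
  (tau Dstar a.1 > tau Dstar b.1)
  || ((tau Dstar a.1 == tau Dstar b.1) && (tau D2 a.2 >= tau D2 b.2)).

Definition first_loop_step s t : Prop :=
  exists x y : T,
    is_minimal (prec_REV (st_D2 s)) (st_REV s) (x, y) /\
    let Dstar := add_arcs (st_Dstar s) [set (y, x)] in
    let C := reversal_Cx (st_D2 s) x y :|: reversal_Cy (st_D2 s) x y in
    t = {| st_Dstar := Dstar;
           st_D2 := reverse_arc (st_D2 s) x y;
           st_DIR := st_DIR s
                     :|: [set a in C | tau Dstar a.1 < tau Dstar a.2];
           st_REV := (st_REV s :\ (x, y))
                     :|: [set a in C | tau Dstar a.1 > tau Dstar a.2];
           st_EQ := st_EQ s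
                    :|: [set a in C | tau Dstar a.1 == tau Dstar a.2] |}.

Definition second_loop_step s t : Prop :=
  let Dstar := add_arcs (st_Dstar s) (st_DIR s) in
  if st_EQ s == set0 then
    t = {| st_Dstar := Dstar; st_D2 := st_D2 s;
           st_DIR := set0; st_REV := st_REV s; st_EQ := set0 |}
  else
    exists x y : T,
      is_minimal (prec_EQ Dstar (st_D2 s)) (st_EQ s) (x, y) /\
      let EQ := st_EQ s :\ (x, y) in
      let DIR := [set a in EQ | a.2 == y] in
      t = {| st_Dstar := add_arcs Dstar [set (x, y)]; st_D2 := st_D2 s;
             st_DIR := DIR; st_REV := st_REV s; st_EQ := EQ :\: DIR |}.

Definition fuse_final s : Prop :=
  [/\ st_REV s = set0, st_EQ s = set0 & st_DIR s = set0].

(* The second loop never changes REV, so the emptiness of REV tells which of  *)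
(* the two successive loops is being executed. The relation is not functional *)
(* because ties between minimal arcs are broken arbitrarily.                  *)
Definition fuse_step s t : Prop :=
  (st_REV s <> set0 /\ first_loop_step s t)
  \/ [/\ st_REV s = set0, ~ fuse_final s & second_loop_step s t].

Definition fuse_dags_output D1 D2 Dstar D2' : Prop :=
  exists s,
    [/\ Relation_Operators.clos_refl_trans_1n _ fuse_step (fuse_init D1 D2) s,
        fuse_final s, Dstar = st_Dstar s & D2' = st_D2 s].

(* Every execution from s reaches a final state, however ties are broken. *)
Inductive fuse_halts s : Prop :=
  | FuseHaltsFinal : fuse_final s -> fuse_halts s
  | FuseHaltsStep : (exists t, fuse_step s t) ->
      (forall t, fuse_step s t -> fuse_halts t) -> fuse_halts s.

End Fuse.

(* Main.v *)
Require Import Defs.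
From mathcomp Require Import all_boot.

(** Adding to a DAG arcs that go up in topological value does not change the
    value, so [tau] of the fused graph is constant during the first loop. An arc
    chosen from [REV] can be reversed because a second path between its ends
    would contain an arc of [REV] with higher priority. Reversals never delete
    an adjacency: each one either enlarges the second graph or shrinks [REV],
    which bounds the first loop. In the second loop the chosen arc [(x, y)] of
    [EQ] changes, among the nodes of value at most that of [x], only the value
    of [y], and no other arc of [EQ] is left at [y]. *)

Set Implicit Arguments.
Unset Strict Implicit.
Unset Printing Implicit Defensive.

(** * Topological values, and how they react to added arcs *)

Section TopologicalValue.
Variable T : finType.
Implicit Types (D : digraph T) (A : {set T * T}) (x y u v : T).

Lemma in_preds D x y :
  is_digraph D -> (y \in preds D x) = ((y, x) \in arcs D).
Proof.
move=> /subsetP gD; rewrite inE; case yx: (_ \in arcs D); last by rewrite andbF.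
by have := gD _ yx; rewrite inE => /andP[/= ->].
Qed.

Lemma arc_nodes D x y :
  is_digraph D -> (x, y) \in arcs D -> x \in nodes D /\ y \in nodes D.
Proof. by move=> /subsetP gD /gD; rewrite inE => /andP[]. Qed.

(** A closed walk would force the rank of its first node below itself. Every acyclicity proof below
    reduces to choosing a rank [g]. *)
Lemma acyclic_rank D (g : T -> nat) :
  (forall u v, (u, v) \in arcs D -> g u < g v) -> acyclic D.
Proof.
move=> ltg x p; apply/negP => /= cp.
have gP : path [rel u v | g u < g v] x (rcons p x).
  by apply: sub_path cp => u v /= /ltg.
have gtr : transitive [rel u v | g u < g v] by move=> v u w /=; apply: ltn_trans.
have /allP/(_ x) := order_path_min gtr gP.
by rewrite mem_rcons mem_head /= ltnn => /(_ isT).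
Qed.

(** Upper bounds absorb both the source case and the maximum of the recursion, so two graphs can be
    compared without unfolding [tau]. *)
Lemma tau_leqP D x n : acyclic D ->
  reflect (forall y, y \in preds D x -> tau D y < n) (tau D x <= n).
Proof.
move=> acD; rewrite tauE //; case: (set_0Vmem (preds D x)) => [-> | [z zx]].
  by rewrite eqxx; apply: ReflectT => y; rewrite inE.
have /negPf-> : preds D x != set0 by apply/set0Pn; exists z.
case: n => [|n]; first by apply: ReflectF => /(_ z zx).
by rewrite ltnS; apply: (iffP (bigmax_leqP _ _ _)).
Qed.

Lemma tau_arc D u v : is_dag D -> (u, v) \in arcs D -> tau D u < tau D v.
Proof.
case=> gD acD uv; have /tau_leqP := leqnn (tau D v).
by apply=> //; rewrite in_preds.
Qed.

Lemma arc_neq D u v : is_dag D -> (u, v) \in arcs D -> u != v.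
Proof. by move=> dD /(tau_arc dD); apply: contraTneq => ->; rewrite ltnn. Qed.

Lemma arc_asym D u v : is_dag D -> (u, v) \in arcs D -> (v, u) \notin arcs D.
Proof.
move=> dD /(tau_arc dD) lt_uv; apply: contraL lt_uv => /(tau_arc dD).
by rewrite -leqNgt => /ltnW.
Qed.

Lemma tau_connect D u v : is_dag D ->
  connect [rel x y | (x, y) \in arcs D] u v -> tau D u <= tau D v.
Proof.
move=> dD /connectP[p up ->]; elim: p u up => [|w p IHp] u //= /andP[uw wp].
exact: leq_trans (ltnW (tau_arc dD uw)) (IHp _ wp).
Qed.

Lemma is_digraph_add_arcs D A :
  is_digraph D -> A \subset setX (nodes D) (nodes D) ->
  is_digraph (add_arcs D A).
Proof. by move=> gD AD; rewrite /is_digraph subUset gD. Qed.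

Lemma add_arcs_dag D A :
  is_dag D -> A \subset setX (nodes D) (nodes D) ->
  (forall u v, (u, v) \in A -> tau D u < tau D v) -> is_dag (add_arcs D A).
Proof.
move=> dD AD ltA; split; first by apply: is_digraph_add_arcs => //; case: dD.
apply: (acyclic_rank (g := tau D)) => u v.
by rewrite inE => /orP[/(tau_arc dD)|/ltA].
Qed.

Lemma tau_add_arcs D A :
  is_dag D -> A \subset setX (nodes D) (nodes D) ->
  (forall u v, (u, v) \in A -> tau D u < tau D v) ->
  tau (add_arcs D A) =1 tau D.
Proof.
move=> dD AD ltA; have [gD' acD'] := add_arcs_dag dD AD ltA.
have [gD acD] := dD.
(* Two values with the same upper bounds are equal, and the bound [n] supports an induction that
   refers to neither graph. *)
suff le n x : (tau (add_arcs D A) x <= n) = (tau D x <= n).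
  by move=> x; apply/eqP; rewrite eqn_leq le leqnn -le leqnn.
elim: n x => [|n IHn] x; apply/idP/idP => [/(tau_leqP _ _ acD') le'x|le_x].
- apply/tau_leqP=> // y; rewrite in_preds // => yx.
  by have := le'x y; rewrite in_preds // inE yx => /(_ isT).
- apply/tau_leqP=> // y; rewrite in_preds // inE => /orP[] yx.
    by have := leq_trans (tau_arc dD yx) le_x.
  by have := leq_trans (ltA _ _ yx) le_x.
- apply/tau_leqP=> // y; rewrite in_preds // => yx.
  by rewrite ltnS -IHn; apply: le'x; rewrite in_preds // inE yx.
apply/tau_leqP=> // y; rewrite in_preds // inE ltnS IHn -ltnS.
case/orP => yx; first exact: leq_trans (tau_arc dD yx) le_x.
exact: leq_trans (ltA _ _ yx) le_x.
Qed.

Section AddEqualArc.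
Variables (D : digraph T) (x y : T).
Hypotheses (dD : is_dag D) (xD : x \in nodes D) (yD : y \in nodes D).
Hypotheses (neq_xy : x != y) (eq_tau : tau D x = tau D y).
Let D' := add_arcs D [set (x, y)].

(** Doubling [tau] frees an odd rank between consecutive levels; moving [y] there puts it above [x]
    and still below every node of the next level. *)
Lemma add_equal_arc_dag : is_dag D'.
Proof.
split; first by apply: is_digraph_add_arcs; [case: dD | rewrite sub1set !inE xD].
apply: (acyclic_rank (g := fun v => (tau D v).*2 + (v == y))) => u v.
rewrite !inE => /orP[/(tau_arc dD) lt_uv | /eqP[-> ->]].
  rewrite (@leq_trans (tau D v).*2) ?leq_addr //.
  by rewrite (leq_trans _ (_ : (tau D u).+1.*2 <= _)) ?leq_double // doubleS;
    case: (u == y); rewrite ?addn1 ?addn0.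
by rewrite (negPf neq_xy) eqxx addn0 addn1 eq_tau.
Qed.

(** Only [y] gains a predecessor. The predecessors of [w] lie strictly below the level of [y], so
    none of them is [y] and induction on the value applies to them. *)
Lemma tau_add_equal_arc w :
  tau D w <= tau D y -> w != y -> tau D' w = tau D w.
Proof.
have [gD acD] := dD; have [gD' acD'] := add_equal_arc_dag.
have predsE v : v != y -> preds D' v = preds D v.
  move=> vy; apply/setP=> u; rewrite !in_preds // !inE xpair_eqE (negPf vy).
  by rewrite andbF orbF.
have [n] := ubnP (tau D w); elim: n w => // n IHn w le_wn le_wy neq_wy.
have IH u : u \in preds D w -> tau D' u = tau D u.
  rewrite in_preds // => /(tau_arc dD) lt_uw; apply: IHn.
  - exact: leq_trans lt_uw le_wn.
  - exact: leq_trans (ltnW lt_uw) le_wy.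
  by apply: contraTneq lt_uw => ->; rewrite -leqNgt.
rewrite !tauE // predsE //; case: ifP => // _; congr _.+1.
exact: eq_bigr.
Qed.

Lemma tau_add_equal_arc_head : tau D y < tau D' y.
Proof.
rewrite -eq_tau -(@tau_add_equal_arc x) ?eq_tau //.
by apply: tau_arc add_equal_arc_dag _; rewrite !inE eqxx orbT.
Qed.

End AddEqualArc.

End TopologicalValue.

(** * Arc reversal: the arcs it adds, their number, and acyclicity *)

Section Reversal.
Variable T : finType.
Implicit Types (D : digraph T) (x y z : T).

Lemma in_reversal_Cx D x y a : is_digraph D ->
  (a \in reversal_Cx D x y) =
  [&& a.2 == x, a.1 != x, (a.1, y) \in arcs D & (a.1, x) \notin arcs D].
Proof.
case: a => z w gD /=; apply/imsetP/and4P => [[u] | [/eqP-> zx zy nzx]].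
  rewrite in_setD1 in_setD !in_preds // => /and3P[ux nux uy] [-> ->].
  by split.
by exists z; rewrite // in_setD1 in_setD !in_preds // zx zy nzx.
Qed.

Lemma in_reversal_Cy D x y a : is_digraph D ->
  (a \in reversal_Cy D x y) =
  [&& a.2 == y, (a.1, x) \in arcs D & (a.1, y) \notin arcs D].
Proof.
case: a => z w gD /=; apply/imsetP/and3P => [[u] | [/eqP-> zx nzy]].
  by rewrite in_setD !in_preds // => /andP[nuy ux] [-> ->]; split.
by exists z; rewrite // in_setD !in_preds // zx nzy.
Qed.

Definition reversal_C D x y := reversal_Cx D x y :|: reversal_Cy D x y.

Lemma arcs_reverse_arc D x y :
  arcs (reverse_arc D x y) =
  (arcs D :|: reversal_C D x y :|: [set (y, x)]) :\ (x, y).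
Proof. by rewrite /= setUA. Qed.

Lemma reversal_C_arcs D x y a :
  is_digraph D -> a \in reversal_C D x y -> a \notin arcs D.
Proof.
case: a => u v gD; rewrite inE in_reversal_Cx // in_reversal_Cy //=.
by case/orP => [/and4P[/eqP->] | /and3P[/eqP->]].
Qed.

Lemma reversal_C_rev D x y :
  is_dag D -> (x, y) \in arcs D -> (y, x) \notin reversal_C D x y.
Proof.
move=> dD xy; have [gD _] := dD.
have nyy : (y, y) \notin arcs D by apply/negP=> /(arc_neq dD); rewrite eqxx.
have nyx := arc_asym dD xy.
rewrite inE in_reversal_Cx // in_reversal_Cy //= (negPf nyy) (negPf nyx).
by rewrite !andbF.
Qed.

Lemma is_digraph_reverse_arc D x y :
  is_digraph D -> (x, y) \in arcs D -> is_digraph (reverse_arc D x y).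
Proof.
move=> gD xy; have [xD yD] := arc_nodes gD xy.
rewrite /is_digraph arcs_reverse_arc; apply/subsetP => -[u v].
rewrite inE => /andP[_]; rewrite !inE in_reversal_Cx // in_reversal_Cy //=.
case/orP => [/orP[|/orP[]]|].
- by case/(arc_nodes gD) => -> ->.
- by case/and4P => /eqP-> _ /(arc_nodes gD)[-> _] _.
- by case/and3P => /eqP-> /(arc_nodes gD)[-> _] _.
by case/eqP => -> ->; rewrite xD yD.
Qed.

(** The arcs of [reversal_C] are all new, and [(y, x)], which is neither old nor among them,
    compensates for the loss of [(x, y)]. This count drives the termination of the first loop. *)
Lemma card_reverse_arc D x y : is_dag D -> (x, y) \in arcs D ->
  #|arcs (reverse_arc D x y)| = #|arcs D| + #|reversal_C D x y|.
Proof.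
move=> dD xy; have [gD _] := dD.
have yxD := arc_asym dD xy; have yxC := reversal_C_rev dD xy.
have dis : arcs D :&: reversal_C D x y = set0.
  apply/setP=> a; rewrite in_setI in_set0; apply/negP=> /andP[aD aC].
  by have := reversal_C_arcs gD aC; rewrite aD.
rewrite arcs_reverse_arc; set B := _ :|: _ :|: _.
have := cardsD1 (x, y) B; rewrite /B !inE xy /= add1n.
rewrite setUC cardsU1 in_setU (negPf yxD) (negPf yxC) add1n => -[<-].
by rewrite cardsU dis cards0 subn0.
Qed.

(* Listing first the nodes that [x] does not reach, then [y], [x] and the other
   nodes reachable from [x] gives a topological order of the reversed graph. *)
Lemma reverse_arc_dag D x y : is_dag D -> (x, y) \in arcs D ->
  (forall z, (z, y) \in arcs D -> z != x ->
     ~~ connect [rel u v | (u, v) \in arcs D] x z) ->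
  is_dag (reverse_arc D x y).
Proof.
move=> dD xy no_path; have [gD acD] := dD.
split; first exact: is_digraph_reverse_arc.
set e := [rel u v | (u, v) \in arcs D] in no_path.
have neq_xy := arc_neq dD xy.
(* [M] exceeds every topological value, so the blocks of the order get disjoint ranges: below [M],
   then [M], [M.+1], and [M.+2] onwards. *)
pose M := (\max_v tau D v).+1.
have ltM v : tau D v < M by rewrite ltnS leq_bigmax.
pose g v := if v == y then M else if v == x then M.+1 else
  if connect e x v then M.+2 + tau D v else tau D v.
have gy : g y = M by rewrite /g eqxx.
have gx : g x = M.+1 by rewrite /g eqxx (negPf neq_xy).
have low z : ~~ connect e x z -> g z < M.
  move=> nxz; rewrite /g (negPf nxz); case: eqP nxz => [->|_].
    by rewrite (connect1 (e := e) xy).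
  by case: eqP => // ->; rewrite connect0.
have pred_x z : (z, x) \in arcs D -> ~~ connect e x z.
  move=> /(tau_arc dD); apply: contraL => /(tau_connect dD).
  by rewrite -leqNgt.
have e_trans u v : connect e x u -> (u, v) \in arcs D -> connect e x v.
  by move=> xu uv; apply: connect_trans xu (connect1 (e := e) uv).
apply: (acyclic_rank (g := g)) => u v; rewrite arcs_reverse_arc.
rewrite in_setD1 !in_setU in_set1 in_reversal_Cx // in_reversal_Cy //=.
case/andP => neq /orP[/orP[uv|/orP[/and4P[/eqP-> ux uy _]|]]|].
(* An old arc into [y] that survives the deletion of [(x, y)] has a tail other than [x], hence
   unreachable by [no_path]. *)
- have [eq_vy | neq_vy] := eqVneq v y.
    rewrite eq_vy gy; apply/low/no_path; first by rewrite -eq_vy.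
    by apply: contraNneq neq => ->; rewrite eq_vy.
  have [eq_vx | neq_vx] := eqVneq v x.
    by rewrite eq_vx gx ltnS ltnW //; apply/low/pred_x; rewrite -eq_vx.
  have gv : g v = if connect e x v then M.+2 + tau D v else tau D v.
    by rewrite /g (negPf neq_vy) (negPf neq_vx).
  have [xu | nxu] := boolP (connect e x u).
    rewrite gv (e_trans u v) // /g.
    case: ifP => _; first by rewrite addSn ltnS addSn ltnW // ltnS leq_addr.
    case: ifP => _; first by rewrite !addSn !ltnS leq_addr.
    by rewrite xu ltn_add2l tau_arc.
  rewrite gv; case: ifP => _.
    by rewrite (leq_trans (low u nxu)) // !addSn -addnS -addnS leq_addr.
  suff -> : g u = tau D u by apply: tau_arc.
  rewrite /g (negPf nxu); case: eqP nxu => [->|_].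
    by rewrite (connect1 (e := e) xy).
  by case: eqP => // ->; rewrite connect0.
- by rewrite gx ltnS ltnW //; apply/low/no_path.
- by case/and3P => /eqP-> /pred_x ux _; rewrite gy low.
by case/eqP=> -> ->; rewrite gx gy.
Qed.

(** [valid_reversals] consumes the first reversal, whereas the algorithm appends a last one. *)
Lemma valid_reversals_rcons D s D' x y :
  valid_reversals D s D' -> (x, y) \in arcs D' ->
  acyclic (reverse_arc D' x y) ->
  valid_reversals D (rcons s (x, y)) (reverse_arc D' x y).
Proof.
elim: s D => [|[u v] s IHs] D /= => [-> // | [uv acR val_s] xy acR'].
by split=> //; apply: IHs.
Qed.

End Reversal.

(** * Existence of minimal arcs for the two priority orders *)

Section Fusion.
Variable T : finType.
Implicit Types (D : digraph T) (s t : fuse_state T) (a b : T * T).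

Lemma minimal_exists (A : finType) (r : rel A) (X : {set A}) :
  reflexive r -> transitive r -> total r -> X != set0 ->
  exists m, is_minimal r X m.
Proof.
move=> r_refl r_tr r_total /set0Pn[a0 a0X].
have [m mX min_m] := @extremumP A A r a0 (mem X) id r_refl r_tr r_total a0X.
by exists m; split=> // a /min_m.
Qed.

Lemma prec_REV_exists D (X : {set T * T}) :
  X != set0 -> exists m, is_minimal (prec_REV D) X m.
Proof.
apply: minimal_exists => [a | b a c | a b]; rewrite /prec_REV.
- by rewrite eqxx leqnn orbT.
- case/orP=> [ab | /andP[/eqP-> ab]].
    case/orP=> [bc | /andP[/eqP<- _]]; last by rewrite ab.
    by rewrite (ltn_trans ab bc).
  case/orP=> [-> // | /andP[-> bc]].
  by rewrite (leq_trans bc) ?orbT.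
by case: ltngtP => //= _; apply: leq_total.
Qed.

Lemma prec_EQ_exists D D' (X : {set T * T}) :
  X != set0 -> exists m, is_minimal (prec_EQ D D') X m.
Proof.
apply: minimal_exists => [a | b a c | a b]; rewrite /prec_EQ.
- by rewrite eqxx leqnn orbT.
- case/orP=> [ab | /andP[/eqP-> ab]].
    case/orP=> [bc | /andP[/eqP<- _]]; last by rewrite ab.
    by rewrite (ltn_trans bc ab).
  case/orP=> [-> // | /andP[-> bc]].
  by rewrite (leq_trans bc) ?orbT.
by case: ltngtP => //= _; apply: leq_total.
Qed.

(** * The invariant shared by both loops *)

Definition st_pending s : {set T * T} := st_DIR s :|: st_REV s :|: st_EQ s.

(** Once nothing is pending, [inv_sub], [inv_cover] and [inv_D1] together give the equality of arc
    sets. The sorting of pending arcs always refers to the current [st_Dstar], so each step has to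
    control how [tau] changes. *)
Record fuse_inv D1 D2 s : Prop := FuseInv {
  inv_nodes : nodes (st_Dstar s) = nodes D1 :|: nodes D2;
  inv_nodes2 : nodes (st_D2 s) = nodes D2;
  inv_Dstar : is_dag (st_Dstar s);
  inv_D2 : is_dag (st_D2 s);
  inv_D1 : arcs D1 \subset arcs (st_Dstar s);
  inv_sub : arcs (st_Dstar s) \subset arcs D1 :|: arcs (st_D2 s);
  inv_pending : st_pending s \subset arcs (st_D2 s);
  inv_cover : arcs (st_D2 s) \subset arcs (st_Dstar s) :|: st_pending s;
  inv_DIR : forall u v, (u, v) \in st_DIR s ->
    tau (st_Dstar s) u < tau (st_Dstar s) v;
  inv_REV : forall u v, (u, v) \in st_REV s ->
    tau (st_Dstar s) v < tau (st_Dstar s) u;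
  inv_EQ : forall u v, (u, v) \in st_EQ s ->
    tau (st_Dstar s) u = tau (st_Dstar s) v;
  inv_valid : exists r, valid_reversals D2 r (st_D2 s)
}.

Lemma fuse_init_inv D1 D2 :
  is_dag D1 -> is_dag D2 -> fuse_inv D1 D2 (fuse_init D1 D2).
Proof.
move=> [gD1 acD1] dD2; split=> //=.
- split=> //; apply: subset_trans gD1 _.
  by apply/subsetP => a; rewrite !inE => /andP[-> ->].
- exact: subsetUl.
- by apply/subsetP => a; rewrite !inE => /orP[/orP[]|] /andP[].
- apply/subsetP => a; rewrite !inE => -> /=.
  by case: (a \in arcs D1) => //=; case: ltngtP.
- by move=> u v; rewrite inE => /and3P[].
- by move=> u v; rewrite inE => /andP[].
- by move=> u v; rewrite inE => /andP[_ /eqP].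
by exists [::].
Qed.

(** * Preservation of the invariant by each loop *)

Section Invariant.
Variables (D1 D2 : digraph T) (s : fuse_state T).
Hypothesis inv_s : fuse_inv D1 D2 s.
Let Dstar := st_Dstar s.
Let E := st_D2 s.

Lemma pending_arcs u v : (u, v) \in st_pending s -> (u, v) \in arcs E.
Proof. exact/subsetP/inv_pending/inv_s. Qed.

Lemma arc_in_nodes u v : (u, v) \in arcs E ->
  (u \in nodes Dstar) && (v \in nodes Dstar).
Proof.
case: (inv_D2 inv_s) => gE _ /(arc_nodes gE).
by rewrite (inv_nodes inv_s) (inv_nodes2 inv_s) !inE => -[-> ->]; rewrite !orbT.
Qed.

Lemma REV_arc u v : (u, v) \in st_REV s -> (u, v) \in arcs E.
Proof. by move=> uv; apply: pending_arcs; rewrite !inE uv orbT. Qed.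

Lemma EQ_arc u v : (u, v) \in st_EQ s -> (u, v) \in arcs E.
Proof. by move=> uv; apply: pending_arcs; rewrite !inE uv orbT. Qed.

Lemma DIR_arc u v : (u, v) \in st_DIR s -> (u, v) \in arcs E.
Proof. by move=> uv; apply: pending_arcs; rewrite !inE uv. Qed.

(** By [inv_cover] the arc is in [Dstar] or pending, and arcs of [Dstar], [DIR] and [EQ] never go
    down in value. *)
Lemma decreasing_arc_REV u v :
  (u, v) \in arcs E -> tau Dstar v < tau Dstar u -> (u, v) \in st_REV s.
Proof.
move=> uv lt_vu; have /subsetP/(_ _ uv) := inv_cover inv_s.
rewrite !inE => /orP[/(tau_arc (inv_Dstar inv_s)) | /orP[/orP[|//]|]].
- by rewrite ltnNge ltnW.
- by move/(inv_DIR inv_s); rewrite ltnNge ltnW.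
by move/(inv_EQ inv_s) => eq_uv; rewrite /Dstar eq_uv ltnn in lt_vu.
Qed.

(* A second path from [x] to [y] would contain an arc of [REV] that precedes
   [(x, y)]: the last arc of the path, or an arc with a head of smaller value
   in the second graph. *)
Lemma minimal_REV_no_path x y z :
  is_minimal (prec_REV E) (st_REV s) (x, y) ->
  (z, y) \in arcs E -> z != x ->
  ~~ connect [rel u v | (u, v) \in arcs E] x z.
Proof.
case=> xyR min_xy zy neq_zx; have dE := inv_D2 inv_s.
apply/negP=> xz.
(* If [z] is above [y] in [Dstar], then [(z, y)] is in [REV] and wins the tie at head [y], because
   the path from [x] makes the value of [z] in [E] exceed that of [x]. *)
have [lt_yz | le_zy] := ltnP (tau Dstar y) (tau Dstar z).
  have lt_xz : tau E x < tau E z.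
    case/connectP: xz neq_zx => -[|w p] /=; first by move=> _ ->; rewrite eqxx.
    case/andP=> xw wp -> _; apply: leq_trans (tau_arc dE xw) _.
    by apply: (tau_connect dE); apply/connectP; exists p.
  have := min_xy _ (decreasing_arc_REV zy lt_yz).
  rewrite /prec_REV /= eqxx ltnn /= => /(_ (ltnW lt_xz)).
  by rewrite leqNgt lt_xz.
(* Otherwise values in [Dstar] would not decrease from [x] through [z] to [y], against [inv_REV]: no
   arc of the path is in [REV], since its head is below [y] in [E] and it would have priority. *)
suff le_xz : tau Dstar x <= tau Dstar z.
  by have := leq_trans (inv_REV inv_s xyR) (leq_trans le_xz le_zy); rewrite ltnn.
have no_REV u v : (u, v) \in arcs E -> tau E v < tau E y ->
    tau Dstar u <= tau Dstar v.
  move=> uv lt_vy; rewrite leqNgt; apply/negP => /(decreasing_arc_REV uv)/min_xy.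
  rewrite /prec_REV /= lt_vy => /(_ isT) /orP[|/andP[/eqP eq_yv _]].
    by rewrite ltnNge ltnW.
  by rewrite eq_yv ltnn in lt_vy.
have {zy neq_zx le_zy} lt_zy := tau_arc dE zy.
case/connectP: xz => p xp def_z; rewrite {}def_z in lt_zy *.
(* The path is peeled from its end because the bound by the value of [y] in [E] passes from the head
   of an arc to its tail. *)
elim/last_ind: p xp lt_zy => [|p v IHp] //.
rewrite rcons_path last_rcons => /andP[xp pv] lt_vy.
apply: leq_trans (no_REV _ _ pv lt_vy); apply: IHp => //.
exact: ltn_trans (tau_arc dE pv) lt_vy.
Qed.

Lemma minimal_REV_reverse_dag x y :
  is_minimal (prec_REV E) (st_REV s) (x, y) -> is_dag (reverse_arc E x y).
Proof.
move=> min_xy; apply: reverse_arc_dag (inv_D2 inv_s) _ _.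
  by apply: REV_arc; case: min_xy.
by move=> z; apply: minimal_REV_no_path.
Qed.

(** The arc [(y, x)] goes up in [Dstar], so no value changes: earlier classifications remain correct
    and the arcs of [C] are sorted by the same values. *)
Lemma first_loop_step_inv t : first_loop_step s t -> fuse_inv D1 D2 t.
Proof.
case=> x [y [min_xy ->]]; have [xyR _] := min_xy.
have xyE := REV_arc xyR; have /andP[xN yN] := arc_in_nodes xyE.
have [dS dE] := (inv_Dstar inv_s, inv_D2 inv_s); have [gE _] := dE.
have yxN : [set (y, x)] \subset setX (nodes Dstar) (nodes Dstar).
  by rewrite sub1set !inE xN yN.
have lt_yx u v : (u, v) \in [set (y, x)] -> tau Dstar u < tau Dstar v.
  by move/set1P=> [-> ->]; apply: (inv_REV inv_s).
have tauE' := tau_add_arcs dS yxN lt_yx.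
have dR := minimal_REV_reverse_dag min_xy.
(* Arcs that do not go down in [Dstar] survive the deletion of [(x, y)] from the second graph. *)
have neq_tau a : tau Dstar a.1 <= tau Dstar a.2 -> a != (x, y).
  by apply: contraTneq => ->; rewrite -ltnNge; apply: (inv_REV inv_s).
have C_neq a : a \in reversal_C E x y -> a != (x, y).
  move=> aC; apply: contraNneq (reversal_C_arcs gE aC) => ->; exact: xyE.
rewrite -/(reversal_C (st_D2 s) x y); set C := reversal_C _ _ _ in C_neq *.
set R := reverse_arc _ x y.
have arcsR : arcs R = (arcs E :|: C :|: [set (y, x)]) :\ (x, y).
  exact: arcs_reverse_arc.
have nodesR : nodes R = nodes D2 := inv_nodes2 inv_s.
have valR : exists r, valid_reversals D2 r R.
  have [r val_r] := inv_valid inv_s; exists (rcons r (x, y)).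
  by apply: valid_reversals_rcons => //; case: dR.
rewrite -/E -/R in dR *.
(* Generalizing over [C] and [R] hides their bodies, so that later rewriting cannot unfold them. *)
move: C C_neq R dR arcsR nodesR valR => C C_neq R dR arcsR nodesR valR.
split; rewrite /st_pending /= ?tauE' //.
- exact: inv_nodes inv_s.
- exact: add_arcs_dag.
- exact: subset_trans (inv_D1 inv_s) (subsetUl _ _).
- rewrite arcsR; apply/subsetP => a.
  rewrite in_setU in_set1 => /orP[aS|/eqP->]; last first.
    by rewrite !inE eqxx !orbT andbT neq_tau ?orbT // ltnW // lt_yx ?set11.
  have /subsetP/(_ _ aS) := inv_sub inv_s; rewrite !inE => /orP[->//|->].
  by rewrite neq_tau ?orbT // ltnW // tau_arc // -surjective_pairing.
- rewrite arcsR; apply/subsetP => -[u v].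
  rewrite !inE.
  case/orP => [/orP[/orP[uv|/andP[uvC _]]
               |/orP[/andP[-> uv]|/andP[uvC _]]]|/orP[uv|/andP[uvC _]]].
  + by rewrite DIR_arc // neq_tau // ltnW // (inv_DIR inv_s).
  + by rewrite C_neq uvC ?orbT.
  + by rewrite REV_arc.
  + by rewrite C_neq uvC ?orbT.
  + by rewrite EQ_arc // neq_tau // (inv_EQ inv_s uv).
  by rewrite C_neq uvC ?orbT.
- rewrite arcsR; apply/subsetP => a.
  rewrite in_setD1 => /andP[neq]; rewrite in_setU => /orP[|aS]; last first.
    by rewrite 2!in_setU aS orbT.
  rewrite in_setU => /orP[aE|aC].
    have /subsetP/(_ _ aE) := inv_cover inv_s; rewrite !inE neq.
    by case/orP=> [->//|/orP[/orP[]|]] ->; rewrite ?orbT.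
  rewrite !in_setU !in_set aC !tauE' /=.
  by case: ltngtP; rewrite ?orbT.
- move=> u v; rewrite !tauE' !inE => /orP[/(inv_DIR inv_s)|/andP[]] //.
  by rewrite !tauE'.
- move=> u v; rewrite !tauE' !in_setU in_setD1 => /orP[/andP[_]|].
    by move/(inv_REV inv_s).
  by rewrite inE => /andP[_]; rewrite !tauE'.
- move=> u v; rewrite !tauE' in_setU => /orP[|].
    by move/(inv_EQ inv_s).
  by rewrite inE => /andP[_ /eqP]; rewrite !tauE'.
Qed.

(** First [DIR] is added, which goes up and keeps all values; then, if [EQ] is not empty, one arc
    between nodes of equal value, whose effect the priority order confines. *)
Lemma second_loop_step_inv t :
  st_REV s = set0 -> second_loop_step s t -> fuse_inv D1 D2 t.
Proof.
move=> REV0; rewrite /second_loop_step; set S := add_arcs _ _.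
have [dS0 dE] := (inv_Dstar inv_s, inv_D2 inv_s).
have DIRN : st_DIR s \subset setX (nodes Dstar) (nodes Dstar).
  by apply/subsetP => -[u v] /DIR_arc/arc_in_nodes; rewrite inE.
have tauS : tau S =1 tau Dstar := tau_add_arcs dS0 DIRN (inv_DIR inv_s).
have dS : is_dag S := add_arcs_dag dS0 DIRN (inv_DIR inv_s).
have subS : arcs S \subset arcs D1 :|: arcs E.
  rewrite subUset (inv_sub inv_s) /=; apply/subsetP => -[u v] /DIR_arc uv.
  by rewrite inE uv orbT.
have D1S : arcs D1 \subset arcs S.
  exact: subset_trans (inv_D1 inv_s) (subsetUl _ _).
have ES : arcs E \subset arcs S :|: st_EQ s.
  apply/subsetP => a aE; have /subsetP/(_ _ aE) := inv_cover inv_s.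
  by rewrite /st_pending REV0 setU0 !inE orbA.
have [EQ0 -> | _ [x [y [min_xy ->]]]] := eqVneq (st_EQ s) set0.
  split; rewrite /st_pending /= ?REV0 ?setU0 ?sub0set //.
  - exact: inv_nodes inv_s.
  - exact: inv_nodes2 inv_s.
  - by rewrite EQ0 setU0 in ES.
  - by move=> u v; rewrite inE.
  - by move=> u v; rewrite inE.
  - by move=> u v; rewrite inE.
  exact: inv_valid inv_s.
have [xyQ {}min_xy] := min_xy; have xyE := EQ_arc xyQ.
have neq_xy := arc_neq dE xyE; have /andP[xN yN] := arc_in_nodes xyE.
have eq_xy : tau S x = tau S y by rewrite !tauS (inv_EQ inv_s xyQ).
have max_x u v : (u, v) \in st_EQ s -> tau S u <= tau S x.
  by move=> /min_xy; rewrite leqNgt /prec_EQ /=; case: ltngtP => //= _ /(_ isT).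
(* An arc of [EQ] leaving [y] would tie with [(x, y)] on the tail and win on the head, which is
   above [y] in the second graph. *)
have neq_y u v : (u, v) \in st_EQ s -> u != y.
  move=> uvQ; apply/eqP=> eq_uy; have := min_xy _ uvQ.
  have := tau_arc dE (EQ_arc uvQ); rewrite eq_uy => lt_yv.
  rewrite /prec_EQ /= -/S eq_xy ltnn eqxx /= => /(_ (ltnW lt_yv)).
  by rewrite leqNgt lt_yv.
have tau' := tau_add_equal_arc dS xN yN neq_xy eq_xy.
split; rewrite /st_pending /= ?REV0 ?setU0 //.
- exact: inv_nodes inv_s.
- exact: inv_nodes2 inv_s.
- exact: add_equal_arc_dag.
- exact: subset_trans D1S (subsetUl _ _).
- by rewrite subUset subS sub1set inE xyE orbT.
- apply/subsetP => -[u v]; rewrite !inE => /orP[/andP[/andP[_ /EQ_arc]]|] //.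
  by case/and3P => _ _ /EQ_arc.
- apply/subsetP => a /(subsetP ES); rewrite !in_setU => /orP[->//|aQ].
  by rewrite !inE aQ; case: (a == _); case: (_ == y); rewrite ?orbT.
(* The other arcs of [EQ] into [y] now go up: their tails keep a value at most the old one of [y],
   which has risen. *)
- move=> u v; rewrite !inE /= => /andP[/andP[_ uvQ] /eqP eq_vy].
  rewrite eq_vy tau' ?(neq_y u v) //; last by rewrite -eq_xy (max_x u v).
  apply: leq_ltn_trans (tau_add_equal_arc_head dS xN yN neq_xy eq_xy).
  by rewrite -eq_xy (max_x u v).
- by move=> u v; rewrite inE.
(* Arcs left in [EQ] avoid [y] at both ends and do not exceed its old level, so both ends keep their
   value. *)
- move=> u v; rewrite !inE /= => /and3P[nv neq uvQ].
  have eq_uv : tau S u = tau S v by rewrite !tauS (inv_EQ inv_s uvQ).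
  have neq_vy : v != y by move: nv; rewrite neq uvQ.
  by rewrite !tau' ?(neq_y u v) // -eq_xy -?eq_uv (max_x u v).
exact: inv_valid inv_s.
Qed.

End Invariant.

Lemma fuse_step_inv D1 D2 s t :
  fuse_inv D1 D2 s -> fuse_step s t -> fuse_inv D1 D2 t.
Proof.
move=> inv_s [[_ /(first_loop_step_inv inv_s)] | [REV0 _]] //.
exact: second_loop_step_inv.
Qed.

(** * Termination of the two loops *)

Lemma second_loop_halts s : st_REV s = set0 -> fuse_halts s.
Proof.
have [n] := ubnP #|st_EQ s|; elim: n s => // n IHn s le_n REV0.
have [EQ0 | nEQ] := eqVneq (st_EQ s) set0.
  have [DIR0 | nDIR] := eqVneq (st_DIR s) set0; first exact: FuseHaltsFinal.
  have not_final : ~ fuse_final s by case=> _ _ /eqP; rewrite (negPf nDIR).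
  apply: FuseHaltsStep.
    eexists; right; split=> //.
    by rewrite /second_loop_step EQ0 eqxx.
  move=> t [[]|] // [_ _]; rewrite /second_loop_step EQ0 eqxx => ->.
  exact: FuseHaltsFinal.
have not_final : ~ fuse_final s by case=> _ /eqP; rewrite (negPf nEQ).
apply: FuseHaltsStep.
  have [[x y] min_xy] :=
    prec_EQ_exists (add_arcs (st_Dstar s) (st_DIR s)) (st_D2 s) nEQ.
  eexists; right; split=> //; rewrite /second_loop_step (negPf nEQ).
  by exists x, y; split.
move=> t [[]|] // [_ _]; rewrite /second_loop_step (negPf nEQ).
(* [EQ] never grows in this loop and loses at least the chosen arc. *)
case=> x [y [[xyQ _] ->]]; apply: IHn => //=; rewrite -ltnS.
apply: leq_trans le_n; rewrite ltnS (cardsD1 (x, y) (st_EQ s)) xyQ ltnS.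
exact/subset_leq_card/subsetDl.
Qed.

(* A reversal either adds arcs to the second graph, or adds none, and then
   nothing replaces the arc taken from [REV]. *)
Lemma fuse_inv_halts D1 D2 s : fuse_inv D1 D2 s -> fuse_halts s.
Proof.
pose N := #|{: T * T}|.
have le_N (X : {set T * T}) : #|X| <= N by apply: max_card.
(* A lexicographic measure in one number: [REV] has at most [N] arcs, so with weight [N.+1] a single
   new arc of the second graph outweighs any growth of [REV]. *)
pose mu s := (N - #|arcs (st_D2 s)|) * N.+1 + #|st_REV s|.
have [n] := ubnP (mu s); elim: n s => // n IHn s le_n inv_s.
have [REV0 | nREV] := eqVneq (st_REV s) set0; first exact: second_loop_halts.
apply: FuseHaltsStep.
  have [[x y] min_xy] := prec_REV_exists (st_D2 s) nREV.
  by eexists; left; split; [apply/eqP | exists x, y; split].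
move=> t [[_ step_st] | []]; last by move/eqP; rewrite (negPf nREV).
apply: IHn; last exact: first_loop_step_inv step_st.
rewrite -ltnS; apply: leq_trans le_n; rewrite ltnS.
case: step_st => x [y [[xyR _] ->]]; rewrite /mu /=.
rewrite -/(arcs (reverse_arc (st_D2 s) x y)).
have := card_reverse_arc (inv_D2 inv_s) (REV_arc inv_s xyR).
rewrite -/(reversal_C (st_D2 s) x y); set C := reversal_C _ _ _ => cardR.
have [C0 | /set0Pn C_n0] := eqVneq C set0.
  move: cardR; rewrite C0 cards0 addn0 => ->; rewrite ltn_add2l.
  rewrite (cardsD1 (x, y) (st_REV s)) xyR ltnS subset_leq_card //.
  by apply/subsetP => a; rewrite !inE orbF.
have C_gt0 : 0 < #|C| by apply/card_gt0P.
have lt_EN : #|arcs (st_D2 s)| < #|arcs (reverse_arc (st_D2 s) x y)|.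
  by rewrite cardR -[X in X < _]addn0 ltn_add2l.
have lt_gap : N - #|arcs (reverse_arc (st_D2 s) x y)| < N - #|arcs (st_D2 s)|.
  by rewrite ltn_sub2l // (leq_trans lt_EN).
apply: leq_trans (leq_addr _ _); rewrite -addnS.
apply: leq_trans (leq_mul lt_gap (leqnn N.+1)).
by rewrite mulSn addnC leq_add2r ltnS.
Qed.

End Fusion.

Theorem mainTheorem3 (T : finType) (D1 D2 : digraph T)
    (dagD1 : is_dag D1) (dagD2 : is_dag D2) :
  fuse_halts (fuse_init D1 D2) /\
  forall Dstar D2' : digraph T,
    fuse_dags_output D1 D2 Dstar D2' ->
    [/\ is_dag Dstar /\ is_dag D2',
        arcs Dstar = arcs D1 :|: arcs D2',
        (let S1 := arcs D1 :\: arcs D2' in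
         let S2 := arcs D2' :\: arcs D1 in
         let S3 := arcs D1 :&: arcs D2' in
         is_projection Dstar (nodes D1) (S1 :|: S3) D1 /\
         is_projection Dstar (nodes D2) (S2 :|: S3) D2')
      & exists s : seq (T * T), valid_reversals D2 s D2'].
Proof.
have inv_init := fuse_init_inv dagD1 dagD2.
split; first exact: fuse_inv_halts inv_init.
move=> Dstar D2' [s [run_s [REV0 EQ0 DIR0] -> ->]].
have inv_s : fuse_inv D1 D2 s.
  elim: run_s inv_init {REV0 EQ0 DIR0} => // s1 s2 s3 step_s _ IHs inv_s1.
  exact/IHs/(fuse_step_inv inv_s1 step_s).
(* With nothing pending, [inv_cover] supplies the inclusion missing from [inv_sub] and [inv_D1]. *)
have pending0 : st_pending s = set0 by rewrite /st_pending REV0 EQ0 DIR0 !setU0.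
have arcsE : arcs (st_Dstar s) = arcs D1 :|: arcs (st_D2 s).
  apply/eqP; rewrite eqEsubset (inv_sub inv_s) subUset (inv_D1 inv_s) /=.
  by have := inv_cover inv_s; rewrite pending0 setU0.
have [dS dE] := (inv_Dstar inv_s, inv_D2 inv_s).
split=> //; last exact: inv_valid inv_s.
move=> S1 S2 S3.
have -> : S1 :|: S3 = arcs D1 by rewrite setUC setID.
have -> : S2 :|: S3 = arcs (st_D2 s) by rewrite /S3 setIC setUC setID.
split; split; rewrite ?arcsE ?(inv_nodes inv_s) ?subsetUl ?subsetUr //.
- by case: dagD1.
- by case: (D1).
- by rewrite -(inv_nodes2 inv_s); case: dE.
by rewrite -(inv_nodes2 inv_s); case: (st_D2 s).
Qed.
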